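(* Let $K$ be a field, $S=K[x_1,\ldots,x_n]$, and let $d>1$ and $a_1,\ldots,a_n$ be integers with $d\geq a_1\geq a_2\geq\cdots\geq a_n\geq 1$ and $\sum_{i=1}^n a_i\geq d$. Let $I=I_{d;a_1,\ldots,a_n}\subset S$ be the corresponding ideal of Veronese type and let $A$ be a subset of $[n]=\{1,\ldots,n\}$. Then $$P_A\in\mathrm{Ass}(S/I)\iff \sum_{i=1}^n a_i\geq d-1+|A|\quad\text{and}\quad \sum_{i\notin A}a_i\leq d-1 .$$ Moreover, if for all $i\in A$ we choose integers $b_i$ with $0\leq b_i<a_i$ such that $$\sum_{i\in A}b_i+\sum_{i\notin A}a_i=d-1,$$ then the monomial $z=\prod_{i\in A}x_i^{b_i}\prod_{i\notin A}x_i^{a_i}$ satisfies $I:z=P_A$.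
   Context: The ideal of Veronese type $I_{d;a_1,\ldots,a_n}\subset S$ is the ideal generated by all monomials $x_1^{u_1}\cdots x_n^{u_n}$ with $u_1+\cdots+u_n=d$ and $0\leq u_i\leq a_i$ for all $i$. For $A\subseteq[n]$, $P_A$ denotes the prime ideal of $S$ generated by the variables $x_i$ with $i\in A$. $\mathrm{Ass}(S/I)$ is the set of associated prime ideals of $S/I$. Sums and products over $i\notin A$ run over $i\in[n]\setminus A$. *)

(* Defs.v *)
From HB Require Import structures.
From mathcomp Require Import all_boot all_algebra.
From mathcomp Require Import boolp.
From mathcomp Require Export mpoly.

Set Implicit Arguments.
Unset Strict Implicit.
Unset Printing Implicit Defensive.

Import GRing.Theory.

Local Open Scope ring_scope.
Local Open Scope quotient_scope.

(* An ideal of a commutative ring R is a submodule of the regular module R^o.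
   Membership is classically decided, so that MathComp's boolean predicates
   (idealr_closed, prime_idealr_closed) and quotients apply. *)
Section GeneratedIdeal.
Variables (R : comNzRingType) (G : R -> Prop).

Definition ideal_gen : {pred R^o} :=
  fun f => `[< exists (k : nat) (c g : 'I_k -> R),
                 (forall i, G (g i)) /\ f = \sum_(i < k) c i * g i >].

Lemma ideal_gen_submod_closed : submod_closed ideal_gen.
Proof.
split.
  apply/asboolP; exists 0%N, (fun=> 0), (fun=> 0).
  by split=> [[]//|]; rewrite big_ord0.
move=> r u v /asboolP[k [c [g [Gg ->]]]] /asboolP[l [e [h [Gh ->]]]].
apply/asboolP; exists (k + l)%N.
exists (fun i => match split i with inl j => r * c j | inr j => e j end).
exists (fun i => match split i with inl j => g j | inr j => h j end).
split=> [i|]; first by case: (split i).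
rewrite big_split_ord /= [r *: _]mulr_sumr; congr (_ + _); apply: eq_bigr => i _.
  by rewrite -[lshift _ _]/(unsplit (inl i)) unsplitK mulrA.
by rewrite -[rshift _ _]/(unsplit (inr i)) unsplitK.
Qed.

HB.instance Definition _ :=
  GRing.isSubmodClosed.Build R R^o ideal_gen ideal_gen_submod_closed.

End GeneratedIdeal.

Section QuotientModule.
Variables (R : pzRingType) (V : lmodType R) (W : submodClosed V).

(* submodClosed does not inherit from zmodClosed in MathComp. *)
Definition submod_zmod : {pred V} := fun v => v \in W.
Fact submod_zmod_closed : zmod_closed submod_zmod.
Proof. exact: GRing.submod_closedB (submodClosedP W). Qed.
HB.instance Definition _ :=
  GRing.isZmodClosed.Build V submod_zmod submod_zmod_closed.

Local Notation Q := (Quotient.quot submod_zmod).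

Definition quot_scale (r : R) (x : Q) : Q := \pi_Q (r *: repr x).

Lemma quot_scaleE r (v : V) : quot_scale r (\pi_Q v) = \pi_Q (r *: v).
Proof.
apply/eqP; rewrite -Quotient.idealrBE -scalerBr.
apply: (rpredZ r); rewrite -[_ \in _]/(_ - _ \in submod_zmod).
by rewrite Quotient.idealrBE reprK.
Qed.

Fact quot_scaleA r s x : quot_scale r (quot_scale s x) = quot_scale (r * s) x.
Proof.
elim/quotW: x => v.
by rewrite [quot_scale s _]quot_scaleE !quot_scaleE scalerA.
Qed.

Fact quot_scale1 : left_id 1 quot_scale.
Proof. by elim/quotW => v; rewrite quot_scaleE scale1r. Qed.

Fact quot_scaleDr : right_distributive quot_scale +%R.
Proof.
move=> r; elim/quotW => u; elim/quotW => v.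
by rewrite -raddfD !quot_scaleE scalerDr raddfD.
Qed.

Fact quot_scaleDl x : {morph quot_scale^~ x : r s / r + s}.
Proof. by elim/quotW: x => v r s; rewrite !quot_scaleE scalerDl raddfD. Qed.

(* MathComp's additive quotient V / W, with the induced R-module structure. *)
Definition quotmod : Type := Q.

HB.instance Definition _ := GRing.Zmodule.on quotmod.
HB.instance Definition _ := GRing.Zmodule_isLmodule.Build R quotmod
  quot_scaleA quot_scale1 quot_scaleDr quot_scaleDl.

End QuotientModule.

Definition prime_ideal (R : comNzRingType) (P : {pred R}) : Prop :=
  idealr_closed P /\ prime_idealr_closed P.

Definition ann (R : comNzRingType) (M : lmodType R) (m : M) : {pred R} :=
  [pred r | r *: m == 0].

Definition Ass (R : comNzRingType) (M : lmodType R) (P : {pred R}) : Prop :=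
  prime_ideal P /\ exists m : M, P =i ann m.

Definition colon (R : comNzRingType) (I : {pred R}) (z : R) : {pred R} :=
  [pred f | f * z \in I].

Definition veronese_ideal (K : fieldType) (n d : nat) (a : 'I_n -> nat) :
    submodClosed {mpoly K[n]}^o :=
  ideal_gen (fun f : {mpoly K[n]} => exists u : 'X_{1..n},
    [/\ (\sum_(i < n) u i)%N = d, forall i, (u i <= a i)%N & f = 'X_[u]]).

Definition var_ideal (K : fieldType) (n : nat) (A : {set 'I_n}) :
    submodClosed {mpoly K[n]}^o :=
  ideal_gen (fun f : {mpoly K[n]} => exists2 i, i \in A & f = 'X_i).

(* Main.v *)
(* Call sum_i min(m_i, a_i) the capped degree of the monomial x^m.  A polynomial
   lies in the Veronese type ideal I iff all its monomials have capped degree at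
   least d, and in P_A iff each of its monomials involves a variable of A.  The
   monomial z has capped degree d - 1; its exponents are saturated off A and
   unsaturated on A, so multiplying it by x^m raises the capped degree to at
   least d exactly when x^m involves a variable of A; this gives I : z = P_A.
   Conversely, if P_A = I : g, multiply g by the product of the x_i^(a_i) over
   i not in A, which is not in P_A.  Some monomial of the result is not in I but
   is moved into I by each x_i with i in A, and A is nonempty because the a_i sum
   to at least d; so its capped degree is d - 1, it is saturated off A and
   unsaturated on A, whence both inequalities. *)

Require Import Defs.
From mathcomp Require Import all_boot all_algebra.
From mathcomp Require Import boolp.

Set Implicit Arguments.
Unset Strict Implicit.
Unset Printing Implicit Defensive.

Import GRing.Theory.

Local Open Scope ring_scope.
Local Open Scope quotient_scope.

(** Induction on [s]: a sum below the total capacity leaves some entry under its bound, which is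
    raised by one. This supplies both generators dividing a given monomial and the exponents [b]. *)
Lemma exists_bounded_sum (I : finType) (A : {pred I}) (c : I -> nat) s :
  (s <= \sum_(i in A) c i)%N ->
  exists2 b : I -> nat, forall i, (b i <= c i)%N & (\sum_(i in A) b i)%N = s.
Proof.
elim: s => [_|s IHs s_lt]; first by exists (fun=> 0%N) => //; rewrite big1.
have [b b_le sum_b] := IHs (ltnW s_lt).
have [i Ai bi_lt] : exists2 i, i \in A & (b i < c i)%N.
  apply: contraPP s_lt => noi; apply/negP; rewrite -leqNgt -sum_b.
  apply: leq_sum => i Ai; rewrite leqNgt; apply/negP => bi_lt.
  by apply: noi; exists i.
exists (fun j => (b j + (j == i))%N) => [j|].
  by have [->|_] := eqVneq; rewrite ?addn1 ?addn0.
rewrite big_split /= sum_b (bigD1 i) //= eqxx big1 ?addn1 // => j.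
by case/andP=> _ /negPf->.
Qed.

(** * Monomial ideals: membership and primality *)

Section MonomialIdeals.
Variables (K : fieldType) (n : nat).
Implicit Types (f : {mpoly K[n]}) (m u w : 'X_{1..n}).

Lemma mem_monomial_ideal (G : 'X_{1..n} -> Prop) (gens : {mpoly K[n]} -> Prop) f :
  (forall g, gens g <-> exists2 u, G u & g = 'X_[u]) ->
  f \in ideal_gen gens <->
  {in msupp f, forall m, exists2 u, G u & (u <= m)%MM}.
Proof.
move=> gensE; split.
  case/asboolP=> k [c [g [g_gens ->]]] m /msupp_sum_le/flattenP[s].
  case/mapP=> i _ -> m_i; have /gensE[u Gu gE] := g_gens i.
  exists u => //; move: m_i; rewrite gE (perm_mem (msuppMX _ _)).
  by case/mapP=> m' _ ->; apply: lem_addr.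
(* Each term of [f] is a multiple of the generator dividing its monomial. *)
move=> suppf; rewrite [f]mpolyE big_seq; apply: rpred_sum => m /suppf[u Gu le_um].
rewrite -(submK le_um) mpolyXD scalerAl.
have Xu_in : 'X_[u] \in ideal_gen gens.
  apply/asboolP; exists 1%N, (fun=> 1), (fun=> 'X_[u]).
  by split=> [_|]; [apply/gensE; exists u | rewrite big_ord1 mul1r].
exact: (rpredZ (_ : {mpoly K[n]}) Xu_in).
Qed.

Lemma mem_var_ideal (A : {set 'I_n}) f :
  f \in var_ideal K A <->
  {in msupp f, forall m, exists2 i, i \in A & (0 < m i)%N}.
Proof.
have gensE (g : {mpoly K[n]}) : (exists2 i, i \in A & g = 'X_i) <->
    exists2 u, (exists2 i, i \in A & u = U_(i)%MM) & g = 'X_[u].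
  split=> [[i Ai ->]|[_ [i Ai ->] ->]]; last by exists i.
  by exists U_(i)%MM => //; exists i.
rewrite (mem_monomial_ideal _ gensE); split=> suppf m /suppf.
  case=> _ [i Ai ->] /mnm_lepP/(_ i); rewrite mnm1E eqxx.
  by exists i.
case=> i Ai m_i; exists U_(i)%MM; first by exists i.
by apply/mnm_lepP=> j; rewrite mnm1E; case: eqP => // <-.
Qed.

(** A ring endomorphism whose kernel is [P_A]; primality is read off from it. *)
Definition kill_vars (A : {set 'I_n}) f : {mpoly K[n]} :=
  f \mPo [tuple if i \in A then 0 else 'X_i | i < n].

Lemma kill_varsX (A : {set 'I_n}) m :
  kill_vars A 'X_[m] = if [exists i in A, (0 < m i)%N] then 0 else 'X_[m].
Proof.
rewrite /kill_vars comp_mpolyX; case: ifP => [/exists_inP[i Ai m_i]|noA].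
  by rewrite (bigD1 i) //= tnth_mktuple Ai expr0n -[_ == _]negbK -lt0n m_i mul0r.
rewrite mpolyXE_id; apply: eq_bigr => i _; rewrite tnth_mktuple.
case: ifP => // Ai; suff -> : m i = 0%N by rewrite !expr0.
by apply: contraFeq noA => m_i; apply/exists_inP; exists i; rewrite // lt0n.
Qed.

Lemma kill_vars_eq0 (A : {set 'I_n}) f :
  (kill_vars A f == 0) = (f \in var_ideal K A).
Proof.
pose hit m := [exists i in A, (0 < m i)%N].
have killE : kill_vars A f = \sum_(m <- msupp f | ~~ hit m) f@_m *: 'X_[m].
  rewrite /kill_vars comp_mpolyEX [RHS]big_mkcond; apply: eq_bigr => m _.
  by rewrite [_ \mPo _]kill_varsX; case: ifP => Hm; rewrite /hit Hm ?scaler0.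
apply/eqP/idP => [f0|/mem_var_ideal suppf]; last first.
  rewrite killE big_seq_cond big1 // => m /andP[/suppf m_hit].
  by case: m_hit => i Ai m_i /existsP[]; exists i; rewrite Ai.
apply/mem_var_ideal => m mf; apply/exists_inP.
(* A monomial avoiding [A] keeps its coefficient under [kill_vars], so that coefficient must
   vanish. *)
apply: contraTT mf => Nhit; rewrite -mcoeff_eq0; apply: contraPT f0 => fm.
have mf : m \in msupp f by rewrite mcoeff_msupp.
move/(congr1 (mcoeff m)); rewrite killE raddf_sum /= mcoeff0 -big_filter.
rewrite (bigD1_seq m) ?filter_uniq ?mem_filter ?msupp_uniq ?mf ?andbT //=.
rewrite mcoeffZ mcoeffX eqxx mulr1 big1 ?addr0; first exact/eqP.
by move=> m' /negPf neq; rewrite mcoeffZ mcoeffX neq mulr0.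
Qed.

Lemma var_ideal_prime (A : {set 'I_n}) :
  prime_ideal (R := {mpoly K[n]}) (var_ideal K A).
Proof.
split; first split; first exact: (rpred0 (var_ideal K A)).
- by rewrite -kill_vars_eq0 /kill_vars rmorph1 oner_eq0.
- move=> r u v uP vP; apply: (rpredD _ vP).
  exact: (rpredZ (r : {mpoly K[n]}) uP).
move=> u v; rewrite -!kill_vars_eq0 /kill_vars rmorphM.
by rewrite mulf_eq0.
Qed.

Definition capped_deg (a : 'I_n -> nat) m : nat := \sum_(i < n) minn (m i) (a i).

(** Capped degree at least [d] leaves room under the exponents [minn (m i) (a i)] for a generator
    dividing ['X_[m]]. *)
Lemma mem_veronese d (a : 'I_n -> nat) f :
  f \in veronese_ideal K d a <->
  {in msupp f, forall m, (d <= capped_deg a m)%N}.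
Proof.
pose G u := (\sum_(i < n) u i)%N = d /\ forall i, (u i <= a i)%N.
have gensE (g : {mpoly K[n]}) :
    (exists u : 'X_{1..n},
      [/\ (\sum_(i < n) u i)%N = d, forall i, (u i <= a i)%N & g = 'X_[u]]) <->
    exists2 u, G u & g = 'X_[u].
  by split=> [[u [] ? ? ->]|[u [? ?] ->]]; exists u.
rewrite (mem_monomial_ideal _ gensE); split=> suppf m /suppf.
  case=> u [<- u_le] /mnm_lepP le_um; apply: leq_sum => i _.
  by rewrite leq_min le_um u_le.
case/exists_bounded_sum=> b b_le sum_b.
have {}b_le i : (b i <= m i)%N && (b i <= a i)%N by rewrite -leq_min.
exists [multinom b i | i < n]; [split|apply/mnm_lepP] => [|i|i].
- by rewrite -[RHS]sum_b; apply: eq_bigr => i _; rewrite mnmE.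
- by rewrite mnmE; case/andP: (b_le i).
- by rewrite mnmE; case/andP: (b_le i).
Qed.

Lemma mem_veroneseMX d (a : 'I_n -> nat) f w :
  f * 'X_[w] \in veronese_ideal K d a <->
  {in msupp f, forall m, (d <= capped_deg a (m + w))%N}.
Proof.
rewrite mem_veronese; split=> supp m.
  move=> mf; apply: supp; rewrite (perm_mem (msuppMX _ _)).
  by apply/mapP; exists m; rewrite // addmC.
by rewrite (perm_mem (msuppMX _ _)) => /mapP[m' /supp le ->]; rewrite addmC.
Qed.

End MonomialIdeals.

(** Identifies the annihilator of the class of [z] with the colon ideal [I : z]. *)
Lemma quot_scale_pi_eq0 (R : comNzRingType) (I : submodClosed R^o) (r z : R) :
  (r *: (\pi_(Quotient.quot (submod_zmod I)) (z : R^o) : quotmod I) == 0)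
  = (r * z \in I).
Proof.
pose pi_I := \pi_(Quotient.quot (submod_zmod I)).
rewrite [r *: _]quot_scaleE -[0 : quotmod I](raddf0 pi_I).
by rewrite -Quotient.idealrBE subr0.
Qed.

(** * Colon ideals and associated primes of Veronese type ideals *)

Section VeroneseColon.
Variables (K : fieldType) (n d : nat) (a : 'I_n -> nat) (A : {set 'I_n}).

Local Notation I := (veronese_ideal K d a).
Local Notation P := (var_ideal K A).

Lemma colon_veronese (b : 'I_n -> nat) :
  (0 < d)%N -> (forall i, i \in A -> (b i < a i)%N) ->
  (\sum_(i in A) b i + \sum_(i | i \notin A) a i)%N = (d - 1)%N ->
  colon (R := {mpoly K[n]}) I
    ((\prod_(i in A) 'X_i ^+ b i) * (\prod_(i | i \notin A) 'X_i ^+ a i)) =i P.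
Proof.
move=> d_gt0 b_lt sum_ba; pose c i := if i \in A then b i else a i.
pose w := [multinom c i | i < n].
have -> : \prod_(i in A) 'X_i ^+ b i * \prod_(i | i \notin A) 'X_i ^+ a i
          = 'X_[w] :> {mpoly K[n]}.
  rewrite mpolyXE_id [RHS](bigID (mem A)) /=.
  by congr (_ * _); apply: eq_bigr => i Ai; rewrite mnmE /c ?(negPf Ai) ?Ai.
have c_le i : (c i <= a i)%N by rewrite /c; case: ifP => // /b_lt/ltnW.
have sum_c : (\sum_(i < n) c i)%N = (d - 1)%N.
  rewrite -sum_ba (bigID (mem A)) /=.
  by congr (_ + _)%N; apply: eq_bigr => i Ai; rewrite /c ?(negPf Ai) ?Ai.
have minE (m : 'X_{1..n}) i : (c i <= minn ((m + w)%MM i) (a i))%N.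
  by rewrite leq_min c_le mnmDE mnmE leq_addl.
have capE (m : 'X_{1..n}) :
    (d <= capped_deg a (m + w))%N = [exists i in A, (0 < m i)%N].
  apply/idP/exists_inP => [|[i Ai m_i]].
    apply: contraPP => noi; apply/negP; rewrite -ltnNge -(prednK d_gt0) ltnS.
    rewrite -subn1 -sum_c; apply: leq_sum => i _; rewrite geq_min.
    rewrite mnmDE mnmE /c; case: ifP => Ai; last by rewrite leqnn orbT.
    suff -> : m i = 0%N by rewrite leqnn.
    by case: (posnP (m i)) => // m_i; case: noi; exists i.
  (* Index [i] contributes at least [b i + 1], since [b i < a i]; every other index [j] contributes
     at least [c j]. *)
  rewrite -(prednK d_gt0) -subn1 -sum_c /capped_deg (bigD1 i) //=.
  rewrite [X in (_ <= X)%N](bigD1 i) //= -addSn leq_add //; last exact: leq_sum.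
  by rewrite leq_min mnmDE mnmE /c Ai b_lt // andbT -add1n leq_add2r.
move=> f; apply/idP/idP => [/mem_veroneseMX suppf|/mem_var_ideal suppf].
  by apply/mem_var_ideal => m /suppf; rewrite capE => /exists_inP.
by apply/mem_veroneseMX => m /suppf/exists_inP; rewrite capE.
Qed.

Lemma Ass_veroneseP :
  (0 < d)%N -> (d <= \sum_(i < n) a i)%N -> (forall i, (0 < a i)%N) ->
  Ass (quotmod I) P <->
     (d - 1 + #|A| <= \sum_(i < n) a i)%N /\
     (\sum_(i | i \notin A) a i <= d - 1)%N.
Proof.
move=> d_gt0 sum_a a_gt0.
have sumaE : (\sum_(i < n) a i = \sum_(i in A) a i + \sum_(i | i \notin A) a i)%N.
  exact: bigID.
have sumAE : (\sum_(i in A) a i = \sum_(i in A) (a i).-1 + #|A|)%N.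
  rewrite -sum1_card -big_split; apply: eq_bigr => i _ /=.
  by rewrite addn1 prednK.
split=> [[_ [x annx]]|[le_sum leA]].
  (* Multiplying the witness [g] by [X^w], which lies outside [P], saturates
     all exponents off [A] without leaving the complement of [I]. *)
  pose c i := if i \in A then 0%N else a i; pose w := [multinom c i | i < n].
  pose g : {mpoly K[n]} := repr (x : Quotient.quot (submod_zmod I)).
  have memP f : f \in P = (f * g \in I).
    by rewrite annx -quot_scale_pi_eq0 reprK.
  have XwNP : 'X_[w] \notin P.
    apply/negP => /mem_var_ideal/(_ w); rewrite msuppX mem_head.
    by case=> // i Ai; rewrite mnmE /c Ai.
  have [m mg small] : exists2 m, m \in msupp g & (capped_deg a (m + w) < d)%N.
    move: XwNP; rewrite memP mulrC => XwgNI; apply: contrapT => no_m.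
    case/negP: XwgNI; apply/mem_veroneseMX => m mg; rewrite leqNgt; apply/negP.
    by move=> lt_d; apply: no_m; exists m.
  set v := (m + w)%MM in small.
  have minA i : i \notin A -> minn (v i) (a i) = a i.
    move=> /negPf Ai; apply/minn_idPr.
    by rewrite mnmDE mnmE /c Ai leq_addl.
  have capE : capped_deg a v =
      (\sum_(i in A) minn (v i) (a i) + \sum_(i | i \notin A) a i)%N.
    by rewrite /capped_deg (bigID (mem A)) /=; congr (_ + _)%N; apply: eq_bigr.
  have big i : i \in A -> (d <= capped_deg a (m + U_(i)))%N.
    move=> Ai; have : 'X_i \in P.
      apply/mem_var_ideal => m'; rewrite msuppX inE => /eqP ->.
      by exists i; rewrite // mnm1E eqxx.
    by rewrite memP mulrC => /mem_veroneseMX; apply.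
  have le_v j : (m j <= v j)%N by rewrite mnmDE leq_addr.
  (* If [v] were saturated at [i], then [m + U_(i)] would have capped degree at most that of [v],
     contradicting [big]. *)
  have v_le i : i \in A -> (minn (v i) (a i) <= (a i).-1)%N.
    move=> Ai; rewrite geq_min -ltnS prednK // ltnNge.
    suff -> : ~~ (a i <= v i)%N by [].
    apply/negP => le_av; move: (leq_trans small (big i Ai)).
    apply/negP; rewrite -leqNgt; apply: leq_sum => j _.
    rewrite leq_min geq_minr mnmDE mnm1E andbT; case: eqP => [<-|_].
      by rewrite (leq_trans (geq_minr _ _)).
    by rewrite addn0 (leq_trans (geq_minl _ _)).
  (* Multiplying by one variable raises the capped degree by at most one; for empty [A], [v] is
     saturated everywhere. *)
  have cap_ge : (d <= (capped_deg a v).+1)%N.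
    have [A0|[i Ai]] := set_0Vmem A.
      rewrite (leq_trans sum_a) // leqW // /capped_deg leq_sum // => i _.
      by rewrite minA ?A0 ?inE.
    apply: leq_trans (big i Ai) _; rewrite /capped_deg (bigD1 i) //=.
    rewrite [X in (_ <= X.+1)%N](bigD1 i) //= -addSn leq_add //.
      rewrite -minnSS leq_min !geq_min mnmDE mnm1E eqxx addn1 ltnS le_v.
      by rewrite leqnSn orbT.
    apply: leq_sum => j ne_ji; rewrite leq_min geq_minr mnmDE mnm1E eq_sym.
    by rewrite (negPf ne_ji) addn0 andbT (leq_trans (geq_minl _ _)).
  split; last first.
    by rewrite -ltnS subn1 prednK // (leq_ltn_trans _ small) // capE leq_addl.
  rewrite sumaE sumAE addnAC leq_add2r leq_subLR add1n.
  apply: leq_trans cap_ge _; rewrite ltnS capE leq_add2r.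
  by apply: leq_sum.
(* The first inequality gives room for exponents [b i <= a i - 1] on [A]; the second makes the
   truncated subtraction exact. *)
have : (d - 1 - \sum_(i | i \notin A) a i <= \sum_(i in A) (a i).-1)%N.
  by rewrite leq_subLR -(leq_add2r #|A|) -addnA -sumAE [X in (_ <= X)%N]addnC -sumaE.
case/exists_bounded_sum => b b_le sum_b.
have b_lt i : i \in A -> (b i < a i)%N by rewrite -(prednK (a_gt0 i)) ltnS.
have sum_ba : (\sum_(i in A) b i + \sum_(i | i \notin A) a i)%N = (d - 1)%N.
  by rewrite sum_b subnK.
split; first exact: var_ideal_prime.
(* The witness is the class of the monomial [z] built from [b], fixed by unification with
   [colon_veronese]. *)
eexists (\pi_(Quotient.quot (submod_zmod I)) _) => f.
by rewrite -(colon_veronese d_gt0 b_lt sum_ba) [RHS]quot_scale_pi_eq0.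
Qed.

End VeroneseColon.

Theorem proposition3p1 (K : fieldType) (n d : nat) (a : 'I_n -> nat)
    (d_gt1 : (1 < d)%N)
    (a_le_d : forall i, (a i <= d)%N)
    (a_noninc : forall i j : 'I_n, (i <= j)%N -> (a j <= a i)%N)
    (a_ge1 : forall i, (1 <= a i)%N)
    (sum_a : (d <= \sum_(i < n) a i)%N)
    (A : {set 'I_n}) :
  let I := veronese_ideal K d a in
  let P := var_ideal K A in
  (Ass (quotmod I) P <->
     (d - 1 + #|A| <= \sum_(i < n) a i)%N /\
     (\sum_(i | i \notin A) a i <= d - 1)%N) /\
  (forall b : 'I_n -> nat,
     (forall i, i \in A -> (b i < a i)%N) ->
     (\sum_(i in A) b i + \sum_(i | i \notin A) a i)%N = (d - 1)%N ->
     let z : {mpoly K[n]} :=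
       (\prod_(i in A) 'X_i ^+ b i) * (\prod_(i | i \notin A) 'X_i ^+ a i) in
     colon (R := {mpoly K[n]}) I z =i P).
Proof.
have d_gt0 := ltnW d_gt1; split; first exact: Ass_veroneseP.
by move=> b b_lt sum_ba; apply: colon_veronese.
Qed.
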